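(* Let $n\ge 3$ be an integer and $F\subseteq E(K_n)$. Then $S_F$ is a mutual-visibility set of maximum cardinality in $L(K_n)$ if and only if $(K_n)_F\cong T(n,3)$.
   Context: The line graph $L(G)$ has vertex set $\{e_{uv}: uv\in E(G)\}$, with $e_{uv}$, $e_{u'v'}$ adjacent iff $uv$ and $u'v'$ share an endpoint. For $F\subseteq E(G)$, $S_F=\{e_{uv}: uv\in F\}$, and $G_F$ denotes the subgraph of $G$ whose edge set is $F$ and whose vertex set is the set of endpoints of edges of $F$. For a connected graph $H$ and $X\subseteq V(H)$, two vertices are $X$-visible if there is a shortest path between them whose internal vertices are not in $X$; $X$ is a mutual-visibility set if every two vertices of $X$ are $X$-visible. The Turán graph $T(n,r)$ is the complete $r$-partite graph of order $n$ whose part sizes differ by at most one. *)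

(* Defs.v *)
From HB Require Import structures.
From mathcomp Require Import all_boot.

Set Implicit Arguments.
Unset Strict Implicit.
Unset Printing Implicit Defensive.

Record sgraph := SGraph {
  svertex :> finType;
  sedge : rel svertex;
  sedge_sym : symmetric sedge;
  sedge_irr : irreflexive sedge }.

Arguments sedge {s} _ _.

Definition sg_iso (G H : sgraph) : Prop :=
  exists2 f : G -> H, bijective f & forall x y, sedge (f x) (f y) = sedge x y.

(* The edge uv is represented by the two-element set [set u; v]. *)
Definition edges (G : sgraph) : {set {set G}} :=
  [set e | [exists u : G, exists v : G, sedge u v && (e == [set u; v])]].

Section LineGraph.
Variable G : sgraph.

Definition line_vertex : finType := {e : {set G} | e \in edges G}.

Definition line_rel : rel line_vertex :=
  fun e f => (e != f) && (val e :&: val f != set0).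

Lemma line_sym : symmetric line_rel.
Proof. by move=> e f; rewrite /line_rel eq_sym setIC. Qed.

Lemma line_irr : irreflexive line_rel.
Proof. by move=> e; rewrite /line_rel eqxx. Qed.

Definition line_graph : sgraph := SGraph line_sym line_irr.

Definition line_set (F : {set {set G}}) : {set line_graph} :=
  [set e : line_vertex | val e \in F].

End LineGraph.

Section EdgeSubgraph.
Variables (G : sgraph) (F : {set {set G}}).

Definition edge_sub_vertex : finType := {v : G | v \in cover F}.

Definition edge_sub_rel : rel edge_sub_vertex :=
  fun u v => sedge (val u) (val v) && ([set val u; val v] \in F).

Lemma edge_sub_sym : symmetric edge_sub_rel.
Proof. by move=> u v; rewrite /edge_sub_rel sedge_sym setUC. Qed.

Lemma edge_sub_irr : irreflexive edge_sub_rel.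
Proof. by move=> u; rewrite /edge_sub_rel sedge_irr. Qed.

(* Meaningful for F \subset edges G. *)
Definition edge_subgraph : sgraph := SGraph edge_sub_sym edge_sub_irr.

End EdgeSubgraph.

Section MutualVisibility.
Variable H : sgraph.

(* The vertex sequence x :: p is a walk from x to y; one of minimum length is a
   path. *)
Definition walk_between (x y : H) (p : seq H) : Prop :=
  path sedge x p /\ last x p = y.

Definition shortest_path (x y : H) (p : seq H) : Prop :=
  walk_between x y p /\ forall q, walk_between x y q -> size p <= size q.

(* x :: p without its first and last vertices. *)
Definition internal_vertices (x : H) (p : seq H) : seq H := behead (belast x p).

Definition visible (X : {set H}) (x y : H) : Prop :=
  exists2 p, shortest_path x y p & {in internal_vertices x p, forall z, z \notin X}.

Definition mutual_visibility_set (X : {set H}) : Prop :=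
  {in X &, forall x y, x != y -> visible X x y}.

Definition maximum_mutual_visibility_set (X : {set H}) : Prop :=
  mutual_visibility_set X /\ forall Y, mutual_visibility_set Y -> #|Y| <= #|X|.

End MutualVisibility.

Section CompleteMultipartite.
Variables (T : finType) (C : eqType) (part : T -> C).

Definition cmp_rel : rel T := fun u v => part u != part v.

Lemma cmp_sym : symmetric cmp_rel.
Proof. by move=> u v; rewrite /cmp_rel eq_sym. Qed.

Lemma cmp_irr : irreflexive cmp_rel.
Proof. by move=> u; rewrite /cmp_rel eqxx. Qed.

(* The parts are the fibres of [part]. *)
Definition complete_multipartite : sgraph := SGraph cmp_sym cmp_irr.

End CompleteMultipartite.

Definition complete_graph (n : nat) : sgraph :=
  complete_multipartite (fun i : 'I_n => i).

(* The parts are the residue classes modulo r in {0, ..., n-1}; [turan_balanced]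
   shows that their sizes differ by at most one. *)
Definition turan_graph (n r : nat) : sgraph :=
  complete_multipartite (fun i : 'I_n => i %% r).

Lemma card_turan_part n r a : a < r ->
  #|[set i : 'I_n | i %% r == a]| = n %/ r + (a < n %% r).
Proof.
move=> ar; have r0 : 0 < r by apply: leq_ltn_trans ar.
rewrite -sum1dep_card; elim: n => [|n IHn].
  by rewrite big_ord0 div0n mod0n ltn0.
rewrite big_mkcond big_ord_recr /= -big_mkcond IHn divnS // modnS.
have lt_nr : n %% r < r by rewrite ltn_mod.
have -> : (r %| n.+1) = ((n %% r).+1 == r).
  rewrite {1}(divn_eq n r) -addnS dvdn_addr ?dvdn_mull //.
  apply/idP/eqP => [/dvdn_leq le|->//].
  by apply/eqP; rewrite eqn_leq lt_nr le.
move: (n %/ r) (n %% r) lt_nr => q m lt_mr.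
case: (eqVneq m.+1 r) => [E|_] /=.
  by move: ar; rewrite -E ltnS addn0 add1n; case: ltngtP; rewrite ?addn0 ?addn1.
by rewrite add0n ltnS; case: ltngtP; rewrite ?addn0 ?addn1.
Qed.

Lemma turan_balanced n r a b : a < r -> b < r ->
  #|[set i : 'I_n | i %% r == a]| <= #|[set i : 'I_n | i %% r == b]|.+1.
Proof.
move=> ar br; rewrite !card_turan_part // -addnS leq_add2l.
by apply: leq_trans (leq_b1 _) _.
Qed.

(* Main.v *)
Require Import Defs.
From HB Require Import structures.
From mathcomp Require Import all_boot fingroup perm zify.

(** In [L(K_n)] two disjoint edges [ab] and [cd] have distance 2, and the midpoints
    of the shortest paths between them are [ac], [ad], [bc] and [bd].  Hence [S_F]
    is a mutual-visibility set iff [F] contains no [K_4], and the theorem is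
    Turan's theorem for [K_4] together with the uniqueness of the extremal graph.
    Zykov symmetrization shows that non-adjacency is transitive in an extremal
    graph, which is therefore complete 3-partite; moving one vertex between two
    parts shows that the parts are balanced.  Conversely, some extremal graph
    exists and is isomorphic to [T(n,3)], so every copy of [T(n,3)] has the
    maximum number of edges. *)

Set Implicit Arguments.
Unset Strict Implicit.
Unset Printing Implicit Defensive.

(** * Counting the edges of extremal [K_4]-free graphs *)

Section Turan.
Variable T : finType.
Implicit Types (e : rel T) (F : {set {set T}}).

Definition degree e x := \sum_y e x y.

(* Each edge is counted twice, once in each direction. *)
Definition darts e := \sum_x degree e x.

Definition K4free e :=
  [forall a, forall b, forall c, forall d,
    ~~ [&& e a b, e a c, e a d, e b c, e b d & e c d]].

Lemma K4freeP e :
  reflect (forall a b c d,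
             [&& e a b, e a c, e a d, e b c, e b d & e c d] -> False)
          (K4free e).
Proof.
apply: (iffP forallP) => [H a b c d K|H a].
  by move: (H a) => /forallP/(_ b)/forallP/(_ c)/forallP/(_ d); rewrite K.
by apply/forallP=> b; apply/forallP=> c; apply/forallP=> d; apply/negP=> /H.
Qed.

Definition turan_extremal e :=
  [/\ symmetric e, irreflexive e, K4free e &
      forall e', symmetric e' -> irreflexive e' -> K4free e' ->
        darts e' <= darts e].

Lemma dartsE e x : symmetric e -> irreflexive e ->
  darts e = (degree e x).*2 + \sum_(u | u != x) \sum_(v | v != x) e u v.
Proof.
move=> sy ir; rewrite /darts (bigD1 x) //= -addnn -addnA; congr addn.
have -> : degree e x = \sum_(v | v != x) e x v.
  by rewrite /degree (bigD1 x) //= ir.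
rewrite -big_split /=.
by apply: eq_bigr => u ux; rewrite /degree (bigD1 x) //= sy.
Qed.

(** Off [x] the two graphs coincide, and each edge at [x] accounts for two darts. The additive form
    avoids truncated subtraction. *)
Lemma darts_agree_off e e' x : symmetric e -> irreflexive e ->
  symmetric e' -> irreflexive e' ->
  (forall u v, u != x -> v != x -> e u v = e' u v) ->
  darts e + (degree e' x).*2 = darts e' + (degree e x).*2.
Proof.
move=> sy ir sy' ir' ag; rewrite (dartsE x sy ir) (dartsE x sy' ir').
rewrite [X in _ + X + _ = _](_ : _ = \sum_(u | u != x) \sum_(v | v != x) e' u v).
  lia.
by apply: eq_bigr => u ux; apply: eq_bigr => v vx; rewrite ag.
Qed.

Lemma extremal_agree_off e e' x : turan_extremal e -> symmetric e' ->
  irreflexive e' -> K4free e' ->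
  (forall u v, u != x -> v != x -> e u v = e' u v) ->
  degree e' x <= degree e x.
Proof.
move=> [sy ir _ mx] sy' ir' k' ag.
have := darts_agree_off sy ir sy' ir' ag; have := mx _ sy' ir' k'; lia.
Qed.

(** * Zykov symmetrization *)

(** Makes [x] a twin of [y]. Being the pullback of [e] along the map that sends [x] to [y], it
    inherits symmetry, irreflexivity and [K_4]-freeness. *)
Definition clone (x y : T) e : rel T :=
  fun u v => e (if u == x then y else u) (if v == x then y else v).

Lemma clone_sym x y e : symmetric e -> symmetric (clone x y e).
Proof. by move=> sy u v; rewrite /clone sy. Qed.

Lemma clone_irr x y e : irreflexive e -> irreflexive (clone x y e).
Proof. by move=> ir u; rewrite /clone ir. Qed.

Lemma clone_K4free x y e : K4free e -> K4free (clone x y e).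
Proof. by move=> /K4freeP k; apply/K4freeP=> a b c d /k. Qed.

Lemma clone_off x y e u v : u != x -> v != x -> e u v = clone x y e u v.
Proof. by rewrite /clone => /negPf-> /negPf->. Qed.

Lemma degree_clone x y e : irreflexive e -> ~~ e y x ->
  degree (clone x y e) x = degree e y.
Proof.
move=> ir /negPf yx; apply: eq_bigr => v _; rewrite /clone eqxx.
by case: eqP => [->|//]; rewrite ir yx.
Qed.

(** Were one of the degrees larger, turning the other vertex into a clone would add edges. *)
Lemma extremal_nonadj_degree e x y :
  turan_extremal e -> ~~ e x y -> degree e x = degree e y.
Proof.
move=> mx; have [sy ir k _] := mx.
suff le a b : ~~ e a b -> degree e b <= degree e a.
  by move=> xy; apply/eqP; rewrite eqn_leq !le // sy.
move=> ab; rewrite -(@degree_clone a b) //; last by rewrite sy.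
apply: extremal_agree_off mx (clone_sym _ _ sy) (clone_irr _ _ ir)
  (clone_K4free _ _ k) _.
exact: clone_off.
Qed.

Lemma extremal_clone e x y :
  turan_extremal e -> ~~ e x y -> turan_extremal (clone x y e).
Proof.
move=> mx xy; have [sy ir k mxe] := mx.
split; [exact: clone_sym|exact: clone_irr|exact: clone_K4free|].
suff -> : darts (clone x y e) = darts e by [].
have := darts_agree_off sy ir (clone_sym x y sy) (clone_irr x y ir)
  (@clone_off x y e).
rewrite degree_clone // 1?sy // (extremal_nonadj_degree mx xy); lia.
Qed.

(* Zykov symmetrization: were [x] adjacent to [z], turning [x] into a clone of
   [y] would keep the graph extremal and the degree of [y], but lower that of
   [z], although [y] and [z] are still non-adjacent. *)
Lemma extremal_nonadj_trans e x y z :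
  turan_extremal e -> ~~ e x y -> ~~ e y z -> ~~ e x z.
Proof.
move=> mx xy yz; apply/negP=> xz; have [sy ir _ _] := mx.
have yx : ~~ e y x by rewrite sy.
have zy : (y == x) = false by apply: contraNF yz => /eqP->.
have zx : (z == x) = false by apply: contraTF xz => /eqP->; rewrite ir.
have mx1 := extremal_clone mx xy.
have yz1 : ~~ clone x y e y z by rewrite /clone zx zy.
have := extremal_nonadj_degree mx1 yz1.
have -> : degree (clone x y e) y = degree e y.
  apply: eq_bigr => v _; rewrite /clone zy.
  by case: eqP => [->|//]; rewrite ir (negPf yx).
rewrite (extremal_nonadj_degree mx yz) /degree.
(* The two degrees of [z] differ only in the term of [x], which is 1 in [e] and 0 in the clone. *)
rewrite (bigD1 x) //= [RHS](bigD1 x) //= sy xz /clone eqxx zx sy (negPf yz) add0n.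
under [in RHS]eq_bigr => v vx do rewrite (negPf vx).
lia.
Qed.

(** * Complete 3-partite structure and balance of the parts *)

(** Non-adjacency is an equivalence relation. Representatives of distinct classes are pairwise
    adjacent, so there are at most three, and the index of the representative serves as color. *)
Lemma K4free_colorable e : symmetric e -> irreflexive e -> K4free e ->
  (forall x y z, ~~ e x y -> ~~ e y z -> ~~ e x z) ->
  exists c : T -> 'I_3, forall u v, e u v = (c u != c v).
Proof.
move=> sy ir /K4freeP k tr.
(* [pick] depends only on the set of non-neighbors, hence on the class of [u]; it never fails, since
   [u] is not adjacent to itself. *)
pose rep u := odflt u [pick v | ~~ e u v].
have repP u : ~~ e u (rep u).
  by rewrite /rep; case: pickP => //= _; rewrite ir.
have rep_eq u v : ~~ e u v -> rep u = rep v.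
  move=> uv; rewrite /rep.
  rewrite (@eq_pick _ (fun w => ~~ e u w) (fun w => ~~ e v w)).
    by case: pickP => //= /(_ v); rewrite ir.
  move=> w; apply/idP/idP; last exact: tr.
  by apply: tr; rewrite sy.
have eE u v : e u v = (rep u != rep v).
  apply/idP/idP; last by apply: contraNT => /rep_eq->.
  apply: contraTN => /eqP E; apply: tr (repP u) _.
  by rewrite E sy.
pose X := enum [set rep u | u : T].
have eX a b : a \in X -> b \in X -> a != b -> e a b.
  rewrite !mem_enum => /imsetP[u _ ->] /imsetP[v _ ->]; rewrite eE.
  have rr w : rep (rep w) = rep w by apply: rep_eq; rewrite sy.
  by rewrite !rr.
have sX : size X <= 3.
  have uX : uniq X := enum_uniq _.
  case E : X => [|a [|b [|c [|d s]]]] //; exfalso.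
  move: uX eX; rewrite E /= !inE !negb_or -!andbA.
  case/and5P => ab ac ad _ /and5P[bc bd _ cd _] eX.
  by apply: (k a b c d); rewrite !eX // !inE eqxx ?orbT.
have iX u : rep u \in X by rewrite mem_enum imset_f.
exists (fun u => inord (index (rep u) X)) => u v; rewrite eE.
congr (~~ _); apply/eqP/eqP => [->//|/(congr1 val)] /=.
have lt w : index (rep w) X < 3 by apply: leq_trans sX; rewrite index_mem.
by rewrite !inordK // => E; rewrite -(nth_index (rep u) (iX u)) E nth_index.
Qed.

Lemma colorable_K4free (c : T -> 'I_3) : K4free (fun u v => c u != c v).
Proof.
apply/K4freeP=> x y z w.
by move: (c x) (c y) (c z) (c w) => [[|[|[|i]]] ?] [[|[|[|j]]] ?]
  [[|[|[|k]]] ?] [[|[|[|l]]] ?].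
Qed.

Lemma degree_coloring (C : finType) (c : T -> C) x :
  degree (fun u v => c u != c v) x + #|[set v | c v == c x]| = #|T|.
Proof.
rewrite -sum1dep_card [X in _ + X]big_mkcond -big_split -sum1_card /=.
by apply: eq_bigr => v _; rewrite eq_sym; case: (c v == c x).
Qed.

Lemma extremal_balanced (c : T -> 'I_3) a b :
  turan_extremal (fun u v => c u != c v) ->
  #|[set v | c v == a]| <= #|[set v | c v == b]|.+1.
Proof.
move=> mx; case: (set_0Vmem [set v | c v == a]) => [->|[x]].
  by rewrite cards0.
rewrite inE => /eqP xa; have [<-|ab] := eqVneq a b; first exact: leqW.
(* Move [x] from class [a] to class [b]: its degree is [#|T|] minus the size of its class, and
   extremality forbids it to grow. *)
pose c' v := if v == x then b else c v.
have /(_ x) := @extremal_agree_off _ (fun u v => c' u != c' v) _ mx.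
have xb : c' x = b by rewrite /c' eqxx.
have := degree_coloring c x; have := degree_coloring c' x.
rewrite xa xb => <- E H.
have ->: #|[set v | c v == b]|.+1 = #|[set v | c' v == b]|.
  rewrite (cardsD1 x [set v | c' v == b]) inE xb eqxx add1n.
  congr S; apply: eq_card => v; rewrite !inE /c'.
  by case: (eqVneq v x) => [->|//]; rewrite xa (negPf ab).
rewrite -(leq_add2l (degree (fun u v => c u != c v) x)) E leq_add2r.
apply: H => [u v|u||u v /negPf ux /negPf vx]; rewrite ?eqxx 1?eq_sym //.
- exact: colorable_K4free.
- by rewrite /c' ux vx eq_sym.
Qed.

(** * Edge sets as relations, and existence of an extremal graph *)

Definition edge_rel F : rel T := fun u v => (u != v) && ([set u; v] \in F).

Lemma edge_rel_sym F : symmetric (edge_rel F).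
Proof. by move=> u v; rewrite /edge_rel eq_sym setUC. Qed.

Lemma edge_rel_irr F : irreflexive (edge_rel F).
Proof. by move=> u; rewrite /edge_rel eqxx. Qed.

Lemma set2_inj (a b u v : T) : a != b ->
  ([set u; v] == [set a; b]) = ((u, v) == (a, b)) || ((u, v) == (b, a)).
Proof.
move=> ab; apply/eqP/orP; last first.
  by move=> [/eqP[-> ->]|/eqP[-> ->]] //; rewrite setUC.
move=> /setP E; move: (E a) (E b) (E u) (E v); rewrite !inE !eqxx !orbT /=.
rewrite !xpair_eqE (eq_sym a u) (eq_sym a v) (eq_sym b u) (eq_sym b v).
case: (eqVneq u a) => [->|ua]; case: (eqVneq u b) => [E1|ub] //=.
all: rewrite ?(negPf ab) //=; by auto.
Qed.

(** Grouped by underlying set, the darts give the two pairs [(a, b)] and [(b, a)] for each member of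
    [F]. *)
Lemma darts_edge_rel F :
  {in F, forall A : {set T}, #|A| = 2} -> darts (edge_rel F) = #|F|.*2.
Proof.
move=> hF; rewrite /darts /degree pair_big /=.
rewrite (eq_bigr (fun p => if edge_rel F p.1 p.2 then 1 else 0)) => [|p _]; last first.
  by case: edge_rel.
rewrite -big_mkcond (partition_big (fun p => [set p.1; p.2]) (mem F)) /=; last first.
  by move=> p /andP[].
rewrite -muln2 -sum_nat_const; apply: eq_bigr => A AF.
have /eqP/cards2P[a [b [ab EA]]] := hF _ AF.
rewrite sum1dep_card -(_ : #|[set (a, b); (b, a)]| = 2); last first.
  by rewrite cards2 xpair_eqE negb_and ab.
apply: eq_card => -[u v]; rewrite !inE /= EA set2_inj //.
apply/andP/idP => [[]//|H]; split=> //; rewrite /edge_rel.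
case/orP: H => /eqP[-> ->]; first by rewrite ab -EA.
by rewrite eq_sym ab setUC -EA.
Qed.

Lemma eq_darts e e' : e =2 e' -> darts e = darts e'.
Proof. by move=> E; apply: eq_bigr => u _; apply: eq_bigr => v _; rewrite E. Qed.

Lemma eq_K4free e e' : e =2 e' -> K4free e -> K4free e'.
Proof.
by move=> E /K4freeP k; apply/K4freeP=> a b c d; rewrite -!E; apply: k.
Qed.

Lemma edge_rel_edges e (sy : symmetric e) (ir : irreflexive e) :
  edge_rel (edges (SGraph sy ir)) =2 e.
Proof.
move=> u v; rewrite /edge_rel inE; apply/andP/idP.
  move=> [uv /existsP[a /existsP[b /andP[/= ab]]]].
  have anb : a != b by apply: contraTneq ab => ->; rewrite ir.
  by rewrite set2_inj // => /orP[] /eqP[-> ->]; rewrite // sy.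
move=> uv; split; first by apply: contraTneq uv => ->; rewrite ir.
by apply/existsP; exists u; apply/existsP; exists v; rewrite /= uv eqxx.
Qed.

Lemma card_edge (G : sgraph) (A : {set G}) : A \in edges G -> #|A| = 2.
Proof.
rewrite inE => /existsP[a /existsP[b /andP[ab /eqP->]]].
rewrite cards2; case: eqP ab => // ->; by rewrite sedge_irr.
Qed.

(** Every symmetric irreflexive relation is the [edge_rel] of its edge set, and [darts] is twice the
    number of edges, so both maxima range over the same graphs. *)
Lemma extremal_edge_relP F : {in F, forall A : {set T}, #|A| = 2} ->
  (K4free (edge_rel F) /\
    forall F', {in F', forall A : {set T}, #|A| = 2} ->
      K4free (edge_rel F') -> #|F'| <= #|F|)
  <-> turan_extremal (edge_rel F).
Proof.
move=> hF; split=> [[k mx]|[_ _ k mx]]; split=> //.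
- exact: edge_rel_sym.
- exact: edge_rel_irr.
- move=> e' sy ir k'; have E := edge_rel_edges sy ir.
  rewrite -(eq_darts E) !darts_edge_rel ?leq_double //; last first.
    exact: (@card_edge (SGraph sy ir)).
  apply: mx; first exact: (@card_edge (SGraph sy ir)).
  by apply: eq_K4free k' => u v; rewrite E.
- move=> F' hF' k'; rewrite -leq_double -!darts_edge_rel //.
  by apply: mx => //; [exact: edge_rel_sym | exact: edge_rel_irr].
Qed.

Lemma extremal_exists : exists e, turan_extremal e.
Proof.
pose P F := K4free (edge_rel F) && [forall A in F, #|A| == 2].
have P0 : P set0.
  apply/andP; split; first by apply/K4freeP=> a b c d; rewrite /edge_rel !inE andbF.
  by apply/forall_inP=> A; rewrite inE.
have hP F : P F -> {in F, forall A : {set T}, #|A| = 2}.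
  by case/andP=> _ /forall_inP h A /h/eqP.
case: (@arg_maxnP _ set0 P (fun F => #|F|) P0) => F PF mx.
exists (edge_rel F); apply/extremal_edge_relP; first exact: hP.
split; first by case/andP: PF.
move=> F' hF' k'; apply: mx; rewrite /P k' /=.
by apply/forall_inP=> A /hF'/eqP.
Qed.

Lemma extremal_coloring e : turan_extremal e ->
  exists2 c : T -> 'I_3, (forall u v, e u v = (c u != c v))
    & forall a b, #|[set v | c v == a]| <= #|[set v | c v == b]|.+1.
Proof.
move=> mx; have [sy ir k mxe] := mx.
have [|c ce] := K4free_colorable sy ir k.
  by move=> x y z; apply: extremal_nonadj_trans.
exists c => // a b; apply: extremal_balanced; split.
- by move=> u v; rewrite eq_sym.
- by move=> u; rewrite eqxx.
- exact: colorable_K4free.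
- by rewrite -(eq_darts ce).
Qed.

End Turan.

(** * Balanced colorings and [T(n,3)] *)

Lemma card_preim_sum (T C : finType) (c : T -> C) :
  \sum_a #|[set v | c v == a]| = #|T|.
Proof.
rewrite -sum1_card (partition_big c predT) //=.
by apply: eq_bigr => a _; rewrite sum1dep_card.
Qed.

Lemma balanced_turan_perm n (c : 'I_n -> 'I_3) :
  (forall a b, #|[set v | c v == a]| <= #|[set v | c v == b]|.+1) ->
  exists p : 'S_n, forall u v, (c u != c v) = (p u %% 3 != p v %% 3).
Proof.
move=> bal; pose m a := #|[set v | c v == a]|.
(* Colors are sorted by decreasing class size, because in [T(n,3)] the smallest residues have the
   larger parts. *)
pose r : rel 'I_3 := fun a b => m b <= m a.
pose s := sort r (enum 'I_3).
have srt : sorted r s by apply: sort_sorted => a b; apply: leq_total.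
have prm : perm_eq s (enum 'I_3) by rewrite perm_sort.
have us : uniq s by rewrite (perm_uniq prm) enum_uniq.
have ins a : a \in s by rewrite (perm_mem prm) mem_enum.
have ss : size s = 3 by rewrite (perm_size prm) size_enum_ord.
have sm : \sum_(a <- s) m a = n.
  by rewrite (perm_big _ prm) big_enum card_preim_sum card_ord.
pose d u := index (c u) s.
have dlt u : d u < 3 by rewrite -ss index_mem.
have dE u v : (c u != c v) = (d u != d v).
  congr (~~ _); apply/eqP/eqP => [E|]; first by rewrite /d E.
  by move=> /(congr1 (nth (c u) s)); rewrite !nth_index.
have dm i : i < 3 -> #|[set u | d u == i]| = m (nth ord0 s i).
  move=> i3; apply: eq_card => u; rewrite !inE.
  apply/eqP/eqP => [<-|E]; first by rewrite nth_index.
  by rewrite /d E index_uniq ?ss.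
have sizes i : i < 3 -> #|[set u | d u == i]| = #|[set u : 'I_n | u %% 3 == i]|.
  move=> i3; rewrite dm // card_turan_part //.
  (* Three decreasing sizes with sum [n] that differ by at most one are determined by [n]. *)
  move: srt sm i3; rewrite -/m; case: (s) ss => [|x [|y [|z []]]] //= _.
  rewrite /r !big_cons big_nil => /and3P[yx zy _] sm.
  have := bal x z; rewrite -/(m x) -/(m z) => xz.
  by case: i => [|[|[|i]]] //= _; lia.
(* Equal class sizes make these two sequences rearrangements of each other; the permutation of
   indices is the desired [p]. *)
pose t1 := [tuple d i | i < n]; pose t2 := [tuple i %% 3 | i < n].
have cm (f : 'I_n -> nat) x : count_mem x (map f (enum 'I_n)) = #|[set u | f u == x]|.
  by rewrite -sum1_count big_map -sum1dep_card big_enum_cond.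
have : perm_eq t1 t2.
  apply/allP=> x _; rewrite /= !cm.
  case: (ltnP x 3) => x3; first by rewrite sizes.
  rewrite !eq_card0 // => u; rewrite !inE; apply/eqP.
    by have := ltn_pmod u (isT : 0 < 3); lia.
  by have := dlt u; lia.
move=> /tuple_permP[p E]; exists p => u v.
suff h w : d w = p w %% 3 by rewrite dE !h.
have -> : d w = tnth t1 w by rewrite tnth_mktuple.
by rewrite (tnth_nth 0) E -tnth_nth !tnth_mktuple.
Qed.

Lemma extremal_turan_perm n (e : rel 'I_n) :
  turan_extremal e <->
  exists p : 'S_n, forall u v, e u v = (p u %% 3 != p v %% 3).
Proof.
have fwd e0 : turan_extremal e0 ->
    exists p : 'S_n, forall u v, e0 u v = (p u %% 3 != p v %% 3).
  move=> /extremal_coloring[c ce /balanced_turan_perm[p pe]].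
  by exists p => u v; rewrite ce pe.
split=> [/fwd//|[p pe]].
(* Reindexing along [q] shows that all copies of [T(n,3)] have equally many darts. *)
have dartsP e0 (q : 'S_n) : (forall u v, e0 u v = (q u %% 3 != q v %% 3)) ->
    darts e0 = darts (fun u v : 'I_n => u %% 3 != v %% 3).
  move=> qe; rewrite (eq_darts qe) /darts /degree.
  rewrite [RHS](reindex_inj (@perm_inj _ q)) /=; apply: eq_bigr => u _.
  by rewrite [RHS](reindex_inj (@perm_inj _ q)).
split.
- by move=> u v; rewrite !pe eq_sym.
- by move=> u; rewrite pe eqxx.
- apply: eq_K4free (colorable_K4free (fun u => inord (p u %% 3))) => u v.
  rewrite pe; congr (~~ _); apply/eqP/eqP => [/(congr1 val)|->//] /=.
  by rewrite !inordK ?ltn_mod.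
- have [e0 mx0] := extremal_exists 'I_n; have [p0 pe0] := fwd _ mx0.
  by rewrite (dartsP _ _ pe) -(dartsP _ _ pe0); case: mx0.
Qed.

(** * Visibility in the line graph of [K_n] *)

Section CompleteGraph.
Variable n : nat.
Local Notation Kn := (complete_graph n).
Implicit Type F : {set {set Kn}}.

Lemma edges_complete (A : {set Kn}) : (A \in edges Kn) = (#|A| == 2).
Proof.
apply/idP/idP => [/card_edge->//|/cards2P[a [b [ab ->]]]].
by rewrite inE; apply/existsP; exists a; apply/existsP; exists b; rewrite eqxx andbT.
Qed.

Lemma set2_edge (a b : Kn) : a != b -> [set a; b] \in edges Kn.
Proof. by rewrite edges_complete cards2 => ->. Qed.

Lemma line_vertexP (x : line_graph Kn) :
  exists a b : Kn, a != b /\ val x = [set a; b].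
Proof.
by have := valP x; rewrite edges_complete => /cards2P[a [b [ab E]]]; exists a, b.
Qed.

(* Two disjoint edges are joined in the line graph by exactly the four edges
   between them, all of which lie in [F] iff the four ends span a [K_4]. *)
Lemma mutual_visibilityP F :
  mutual_visibility_set (line_set F) <-> K4free (edge_rel F).
Proof.
split=> [mv|/K4freeP k].
  apply/K4freeP=> a b c d /and5P[/andP[ab abF] /andP[ac acF] /andP[ad adF]].
  move=> /andP[bc bcF] /andP[/andP[bd bdF] /andP[cd cdF]].
  pose x : line_graph Kn := Sub [set a; b] (set2_edge ab).
  pose y : line_graph Kn := Sub [set c; d] (set2_edge cd).
  pose z : line_graph Kn := Sub [set a; c] (set2_edge ac).
  have xy0 : val x :&: val y = set0.
    apply/setP=> v; rewrite !inE; apply/negP=> /andP[/orP[]/eqP-> /orP[]];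
      exact/negP.
  have xz : sedge x z.
    apply/andP; split; last by apply/set0Pn; exists a; rewrite !inE eqxx.
    rewrite -val_eqE /= eq_sym set2_inj // !xpair_eqE negb_or !negb_and.
    by rewrite (eq_sym c b) bc ab orbT.
  have zy : sedge z y.
    apply/andP; split; last by apply/set0Pn; exists c; rewrite !inE eqxx ?orbT.
    rewrite -val_eqE /= set2_inj // !xpair_eqE negb_or !negb_and.
    by rewrite ac ad.
  have xny : x != y.
    apply/eqP=> E; move: xy0; rewrite -E setIid => /setP/(_ a).
    by rewrite !inE eqxx.
  have [||p [[pw pl] pm] pX] := mv x y _ _ xny; rewrite ?inE //.
  (* The walk through [z] bounds a shortest path by two steps; as [x] and [y] are distinct and
     disjoint, it has exactly one internal vertex [w]. *)
  have /pm : walk_between x y [:: z; y] by split=> //; apply/and3P.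
  case: p pw pl pX {pm} => [|w [|y' []]] //=; rewrite ?andbT.
  - by move=> _ E; rewrite E eqxx in xny.
  - by move=> + E; rewrite E => /andP[_]; rewrite xy0 eqxx.
  move=> /andP[xw wy] E; rewrite {}E in wy *.
  move=> /(_ w (mem_head _ _)); rewrite inE => + _; apply/negP; rewrite negbK.
  case/andP: xw => _ /set0Pn[u]; rewrite inE => /andP[ux uw].
  case/andP: wy => _ /set0Pn[v]; rewrite inE => /andP[vw vy].
  have uv : u != v.
    apply: contra_eqN xy0 => /eqP E; apply/set0Pn; exists u.
    by rewrite inE ux E.
  have [s [t [st Ew]]] := line_vertexP w.
  (* Meeting both of the disjoint edges, [w] consists of one end of each, so it is one of the four
     edges known to lie in [F]. *)
  have -> : val w = [set u; v].
    rewrite Ew; apply/eqP; rewrite set2_inj //.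
    move: uw vw uv; rewrite Ew !inE.
    by move=> /orP[]/eqP-> /orP[]/eqP->; rewrite ?eqxx ?orbT.
  move: ux vy; rewrite !inE.
  by move=> /orP[]/eqP-> /orP[]/eqP->.
move=> x y; rewrite !inE => xF yF xy.
have walk1 q : walk_between x y q -> 0 < size q.
  by case: q => //= -[_ /= E]; rewrite E eqxx in xy.
case: (eqVneq (val x :&: val y) set0) => [xy0|xyn0]; last first.
  exists [:: y] => //; split=> //; split=> //=; rewrite andbT.
  by apply/andP.
have walk2 q : walk_between x y q -> 1 < size q.
  move=> w; have := walk1 _ w; case: q w => [|w [|? ?]] //=.
  by case=> /andP[/andP[_ +] _] /= E; rewrite E xy0 eqxx.
have [a [b [ab Ex]]] := line_vertexP x.
have [c [d [cd Ey]]] := line_vertexP y.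
have dis u v : u \in val x -> v \in val y -> u != v.
  move=> ux vy; apply: contra_eqN xy0 => /eqP E; apply/set0Pn; exists u.
  by rewrite inE ux E.
(* An edge [uv] missing from [F] is an admissible midpoint, and [walk2] makes the path through it
   shortest. *)
have via u v : u \in val x -> v \in val y -> [set u; v] \notin F ->
    visible (line_set F) x y.
  move=> ux vy nF; have uv := dis _ _ ux vy.
  pose z : line_graph Kn := Sub [set u; v] (set2_edge uv).
  exists [:: z; y]; last by move=> w /[!inE] /eqP->.
  split=> //; split=> //=; rewrite andbT; apply/andP; split; apply/andP; split.
  - by apply: contraNneq nF => E; rewrite -[[set u; v]]/(val z) -E.
  - by apply/set0Pn; exists u; rewrite !inE ux eqxx.
  - by apply: contraNneq nF => E; rewrite -[[set u; v]]/(val z) E.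
  - by apply/set0Pn; exists v; rewrite !inE vy eqxx orbT.
have [ax bx] : a \in val x /\ b \in val x by rewrite Ex !inE !eqxx orbT.
have [cy dy] : c \in val y /\ d \in val y by rewrite Ey !inE !eqxx orbT.
(* If none of the four edges is missing, they form a [K_4] with [x] and [y]. *)
case: (boolP ([set a; c] \in F)) => [acF|]; last exact: via.
case: (boolP ([set a; d] \in F)) => [adF|]; last exact: via.
case: (boolP ([set b; c] \in F)) => [bcF|]; last exact: via.
case: (boolP ([set b; d] \in F)) => [bdF|]; last exact: via.
exfalso; apply: (k a b c d); rewrite /edge_rel acF adF bcF bdF -Ex -Ey xF yF.
by rewrite ab cd !dis.
Qed.

Lemma card_line_set F : F \subset edges Kn -> #|line_set F| = #|F|.
Proof.
move=> hF; rewrite -(card_imset _ val_inj); apply: eq_card => A.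
apply/imsetP/idP => [[x]|AF]; first by rewrite inE => xF ->.
by exists (Sub A (subsetP hF _ AF)); rewrite ?inE.
Qed.

(** Turns maximality over vertex sets of the line graph into maximality over edge sets. *)
Lemma line_set_surj (Y : {set line_graph Kn}) :
  exists2 F : {set {set Kn}}, F \subset edges Kn & Y = line_set F.
Proof.
exists [set val x | x in Y].
  by apply/subsetP=> A /imsetP[x _ ->]; apply: valP.
by apply/setP=> x; rewrite inE mem_imset //; apply: val_inj.
Qed.

Lemma maximum_mutual_visibilityP F : F \subset edges Kn ->
  maximum_mutual_visibility_set (line_set F) <-> turan_extremal (edge_rel F).
Proof.
have cE F' : F' \subset edges Kn <-> {in F', forall A : {set Kn}, #|A| = 2}.
  split=> [/subsetP h A /h|h]; first exact: card_edge.
  by apply/subsetP=> A /h/eqP; rewrite edges_complete.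
move=> hF; rewrite -extremal_edge_relP; last exact/cE.
rewrite /maximum_mutual_visibility_set mutual_visibilityP.
split=> -[k mx]; split=> //.
  move=> F' /cE hF' k'; rewrite -!card_line_set //.
  by apply: mx; apply/mutual_visibilityP.
move=> Y; have [F' hF' ->] := line_set_surj Y.
by rewrite mutual_visibilityP !card_line_set // => k'; apply: mx => //; apply/cE.
Qed.

(** The edge subgraph has only the vertices covered by [F], so each direction first shows that [F]
    covers every vertex; the first does so by counting. *)
Lemma edge_subgraph_turanP F : 3 <= n ->
  sg_iso (edge_subgraph F) (turan_graph n 3) <->
  exists p : 'S_n, forall u v, edge_rel F u v = (p u %% 3 != p v %% 3).
Proof.
move=> n3; split=> [[f fb fe]|[p pe]].
  have cov v : v \in cover F.
    have : #|[set: Kn]| <= #|cover F|.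
      rewrite cardsT /= -(bij_eq_card fb) card_sig.
      by apply: subset_leq_card; apply/subsetP.
    move=> le; have /eqP-> : cover F == [set: Kn] by rewrite eqEcard subsetT.
    by rewrite inE.
  pose g (v : 'I_n) : 'I_n := f (Sub v (cov v)).
  have gi : injective g by move=> u v /(bij_inj fb)/(congr1 val).
  by exists (perm gi) => u v; rewrite !permE; symmetry; apply: fe.
have cov v : v \in cover F.
  (* If [p v] has residue 0, take the vertex that [p] sends to 1, otherwise the one sent to 0. *)
  have [w vw] : exists w, edge_rel F v w.
    have n1 : 1 < n by apply: leq_trans n3.
    have n0 : 0 < n by apply: leq_trans n3.
    case: (eqVneq (p v %% 3) 0) => E.
      by exists (p^-1%g (Ordinal n1)); rewrite pe permKV E.
    by exists (p^-1%g (Ordinal n0)); rewrite pe permKV.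
  case/andP: vw => _ vw; apply/bigcupP; exists [set v; w] => //.
  by rewrite !inE eqxx.
exists (fun u : edge_subgraph F => p (val u)); last first.
  by move=> u v; symmetry; apply: pe.
exists (fun v => Sub (p^-1%g v) (cov _)) => u; last by rewrite SubK permKV.
by apply: val_inj; rewrite SubK permK.
Qed.

End CompleteGraph.

Theorem theorem3p2 (n : nat) (hn : 3 <= n) (F : {set {set complete_graph n}})
    (hF : F \subset edges (complete_graph n)) :
  maximum_mutual_visibility_set (line_set F)
  <-> sg_iso (edge_subgraph F) (turan_graph n 3).
Proof.
rewrite maximum_mutual_visibilityP // edge_subgraph_turanP //.
exact: extremal_turan_perm.
Qed.
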